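(* Let $G$ be a graph. Then for every $A\in\mathcal{S}(G)$, with $q_i=q_i(A)$, and every positive integer $t$: (i) $\sum_{i=1}^t q_i\ge\operatorname{RSL}(t)$, and (ii) $q(G)\ge\left\lceil\frac{\operatorname{RSL}(t)}{t}\right\rceil$.
   Context: $G$ is a simple graph on $\{1,\dots,n\}$. $\mathcal{S}(G)$ is the set of real symmetric $n\times n$ matrices $A=[a_{ij}]$ with $a_{ij}\ne0$ iff $ij\in E(G)$ for $i\ne j$ (diagonal unrestricted). $q_i(A)$ is the number of distinct eigenvalues of $A$ of multiplicity at least $i$; $q(G)=\min\{q_1(A):A\in\mathcal{S}(G)\}$. A linkage in $G$ is a subgraph whose components are paths (a single vertex counts as a path); its order is its number of paths. For $\alpha,\beta\subseteq V(G)$, a linkage is an $(\alpha,\beta)$-linkage if $\alpha$ consists of one endpoint of each path and $\beta$ of the other endpoints (a one-vertex path has its vertex in both). If an $(\alpha,\beta)$-linkage exists and $s$ is the minimum number of vertices of an $(\alpha,\beta)$-linkage, an $(\alpha,\beta)$-rigid shortest linkage is the unique $(\alpha,\beta)$-linkage on $s$ vertices (when it is unique). A rigid shortest linkage is an $(\alpha,\beta)$-rigid shortest linkage for some $\alpha,\beta$. $\operatorname{RSL}(t)=\operatorname{RSL}_G(t)$ is the maximum number of vertices in a rigid shortest linkage of order $t$ in $G$. *)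

(* Defs.v *)
From mathcomp Require Import all_boot all_order all_algebra finmap.
From mathcomp Require Import boolp classical_sets cardinality reals.

Set Implicit Arguments.
Unset Strict Implicit.
Unset Printing Implicit Defensive.

Import GRing.Theory Num.Theory.
Local Open Scope ring_scope.

Record sgraph (n : nat) := SGraph {
  adj :> rel 'I_n;
  adj_sym : symmetric adj;
  adj_irr : irreflexive adj }.

Section Spectral.
Variables (R : realType) (n : nat).

Definition in_S (G : sgraph n) (A : 'M[R]_n) : Prop :=
  A^T = A /\ forall i j : 'I_n, i != j -> (A i j != 0) = G i j.

Definition eigmult (A : 'M[R]_n) (a : R) : nat := mup a (char_poly A).

Definition eig_ge (i : nat) (A : 'M[R]_n) : set R :=
  [set a | eigenvalue A a /\ (i <= eigmult A a)%N]%classic.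

(* [fset_set] returns the empty set on infinite sets; see [eig_ge_finite]. *)
Definition qmult (i : nat) (A : 'M[R]_n) : nat := #|` fset_set (eig_ge i A)|.

Lemma eig_ge_finite i A : finite_set (eig_ge i A).
Proof.
apply: contrapT => /(@infinite_set_fset _ _ n.+1)[B BA]; rewrite leqNgt.
move=> /negP; apply; rewrite ltnS.
have p0 : char_poly A != 0 by rewrite monic_neq0 ?char_poly_monic.
have := max_poly_roots p0 _ (fset_uniq B).
rewrite size_char_poly ltnS; apply; apply/allP => a aB.
by rewrite -eigenvalue_root_char; case: (BA _ aB).
Qed.

Definition is_q1_value (G : sgraph n) : pred nat :=
  fun k => `[< exists2 A : 'M[R]_n, in_S G A & qmult 1 A = k >].

Lemma q1_value_exists (G : sgraph n) : exists k, is_q1_value G k.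
Proof.
pose A : 'M[R]_n := \matrix_(i, j) (G i j)%:R.
exists (qmult 1 A); apply/asboolP; exists A => //; split.
  by apply/matrixP => i j; rewrite !mxE adj_sym.
by move=> i j _; rewrite mxE pnatr_eq0 eqb0 negbK.
Qed.

Definition qgraph (G : sgraph n) : nat := ex_minn (q1_value_exists G).

End Spectral.

Section Linkages.
Variable n : nat.
Notation V := 'I_n.
Implicit Types (G : sgraph n) (C alpha beta : {set V}).

Definition edges G : {set {set V}} := [set [set p.1; p.2] | p : V * V & G p.1 p.2].

(* A candidate subgraph is a pair (vertex set, edge set). *)
Definition vepair : finType := ({set V} * {set {set V}})%type.
Implicit Types (H : vepair).

Definition subgraph G H : bool :=
  (H.2 \subset edges G) && [forall f in H.2, f \subset H.1].

Definition sadj H : rel V := fun x y => [set x; y] \in H.2.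

Definition components H : {set {set V}} :=
  [set [set y in H.1 | connect (sadj H) x y] | x in H.1].

(* [p] may be empty, in which case C is a single vertex and a = b.  Entries of
   [s] are distinct, so the [index] condition says that the edges of H inside C
   are exactly the pairs of consecutive entries of [s]. *)
Definition path_between H C (a b : V) : Prop :=
  exists p : seq V, let s := a :: p in
  [/\ uniq s, last a p = b, C = [set x in s] &
      forall x y, x \in C -> y \in C ->
        sadj H x y = (index y s == (index x s).+1)
                     || (index x s == (index y s).+1)].

Definition linkage G H : Prop :=
  subgraph G H /\
  forall C, C \in components H -> exists a b, path_between H C a b.

Definition linkage_order H : nat := #|components H|.

Definition ab_linkage G alpha beta H : Prop :=
  [/\ linkage G H, alpha \subset H.1, beta \subset H.1 &
      forall C, C \in components H ->
        exists a b, [/\ path_between H C a b,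
                        alpha :&: C = [set a] & beta :&: C = [set b]]].

Definition shortest_ab_linkage G alpha beta H : Prop :=
  ab_linkage G alpha beta H /\
  forall H', ab_linkage G alpha beta H' -> (#|H.1| <= #|H'.1|)%N.

Definition rigid_shortest_ab_linkage G alpha beta H : Prop :=
  shortest_ab_linkage G alpha beta H /\
  forall H', ab_linkage G alpha beta H' -> #|H'.1| = #|H.1| -> H' = H.

Definition rigid_shortest_linkage G H : Prop :=
  exists alpha beta, rigid_shortest_ab_linkage G alpha beta H.

(* Equal to 0 when G has no rigid shortest linkage of order t, i.e. t > n. *)
Definition RSL G (t : nat) : nat :=
  \max_(H : vepair | `[< rigid_shortest_linkage G H >] && (linkage_order H == t))
     #|H.1|.

End Linkages.

(* Main.v *)
Require Import Defs.
From mathcomp Require Import finmap boolp classical_sets cardinality reals.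
From mathcomp Require Import sesquilinear spectral complex.
From mathcomp Require Import all_boot all_order perm all_algebra.

(* Let H be an (alpha,beta)-rigid shortest linkage on s vertices, of order t, and
   consider the minor of 'X - A obtained by deleting the rows in beta and the
   columns in alpha.  A nonzero term of its Leibniz expansion is a permutation
   sigma which, followed from each vertex of alpha until it meets beta, traces an
   (alpha,beta)-linkage of G; the degree of the term is the number of fixed points
   of sigma outside beta, hence at most n minus the number of vertices of that
   linkage.  By minimality and uniqueness of H exactly one term has degree n - s
   and the others have smaller degree, so the minor is nonzero of degree n - s.
   As A is symmetric, an eigenvalue a of multiplicity m makes the rank of a - A
   drop by m, so ('X - a)^(m - t) divides the minor.  Hence n - s is at least the
   sum of the m - t over the eigenvalues with m > t, that is, s is at most the sum
   of the min(m, t), which is q_1 + ... + q_t.  Part (ii) follows as q_i <= q_1. *)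

Set Implicit Arguments.
Unset Strict Implicit.
Unset Printing Implicit Defensive.

Import Order.TTheory GRing.Theory Num.Theory.

(** * From permutations to linkages *)

Lemma set2_eq (T : finType) (x y z w : T) :
  [set x; y] = [set z; w] -> (x = z /\ y = w) \/ (x = w /\ y = z).
Proof.
move=> E; have := set21 x y; have := set22 x y; have := set21 z w.
have := set22 z w; rewrite E -{1 2}E !inE.
case/orP=> /eqP-> /orP[]/eqP-> /orP[]/eqP ? /orP[]/eqP ?; subst; tauto.
Qed.

Lemma sadj_sym n (K : vepair n) : symmetric (sadj K).
Proof. by move=> x y; rewrite /sadj setUC. Qed.

(* A permutation [s] is read as the linkage that follows [s] from each vertex of
   [s @: beta] until it first meets [beta]. *)
Section PermToLinkage.
Variables (n : nat) (G : sgraph n) (beta : {set 'I_n}) (s : {perm 'I_n}).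
Hypothesis sG : forall i, i \notin beta -> s i != i -> G i (s i).
Local Notation alpha := (s @: beta).

Definition stop a := find (mem beta) (orbit s a).
Definition segment a := traject s a (stop a).+1.
Definition seg_verts := [set x | [exists a in alpha, x \in segment a]].
Definition perm_linkage : vepair n :=
  (seg_verts, [set [set x; s x] | x in seg_verts :\: beta]).
Local Notation U := seg_verts.
Local Notation H := perm_linkage.

(** Writing [a = s b] with [b] in [beta], the cycle of [a] passes through [b], so [find] succeeds
    within the orbit. *)
Lemma stopP a : a \in alpha ->
  iter (stop a) s a \in beta /\ forall j, j < stop a -> iter j s a \notin beta.
Proof.
case/imsetP=> b bB aE.
have hb : has (mem beta) (orbit s a).
  apply/hasP; exists b => //; rewrite -fconnect_orbit aE.
  by rewrite fconnect_sym ?fconnect1 //; apply: perm_inj.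
have lt_stop : stop a < order s a by rewrite -(size_orbit s a) -has_find.
split; first by have := nth_find a hb; rewrite nth_traject.
move=> j js; have := before_find a js.
by rewrite nth_traject ?(ltn_trans js) // => /negbT.
Qed.

Lemma segmentP a x :
  reflect (exists2 i, i <= stop a & x = iter i s a) (x \in segment a).
Proof. by apply: (iffP trajectP). Qed.

(** Cancelling common iterates of [s] leaves, say, [a] equal to an iterate of [a']. Were it a
    positive iterate, the preimage of [a] under [s], which lies in [beta], would be met before
    [stop a']. Hence segments have no repetition and are pairwise disjoint. *)
Lemma iter_seg_inj a a' i j : a \in alpha -> a' \in alpha ->
  i <= stop a -> j <= stop a' -> iter i s a = iter j s a' -> i = j /\ a = a'.
Proof.
wlog ij : a a' i j / i <= j.
  move=> W aA a'A ia ja E; case/orP: (leq_total i j) => ij; first exact: W.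
  by case: (W a' a j i) => //.
move=> aA a'A ia ja; rewrite -(subnKC ij) iterD => E.
have {E} : a = iter (j - i) s a'.
  move: (iter (j - i) s a') E => c.
  by elim: (i) => //= k IH /perm_inj; apply: IH.
case E : (j - i) => [|k] /=.
  by move=> ->; split=> //; rewrite addn0.
case/imsetP: (aA) => b bB -> /perm_inj bE.
have /negP[] : iter k s a' \notin beta; last by rewrite -bE.
by apply: (stopP a'A).2; rewrite (leq_trans _ ja) // -E leq_subr.
Qed.

Lemma seg_vertsP x :
  reflect (exists a i, [/\ a \in alpha, i <= stop a & x = iter i s a]) (x \in U).
Proof.
rewrite inE; apply: (iffP exists_inP) => [[a aA /segmentP[i ia xE]]|].
  by exists a, i.
by case=> a [i [aA ia xE]]; exists a => //; apply/segmentP; exists i.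
Qed.

Lemma iter_seg_beta a i : a \in alpha -> i <= stop a ->
  (iter i s a \in beta) = (i == stop a).
Proof.
move=> aA ia; have [sB sN] := stopP aA.
case: eqP => [->//|/eqP ni]; apply/negbTE/sN.
by rewrite ltn_neqAle ni.
Qed.

Lemma sadj_linkage x y : sadj H x y =
  ((x \in U :\: beta) && (y == s x)) || ((y \in U :\: beta) && (x == s y)).
Proof.
rewrite /sadj /=; apply/imsetP/orP => [[z zU] /set2_eq|].
  by case=> -[-> ->]; [left|right]; rewrite zU eqxx.
by case=> /andP[zU /eqP->]; [exists x|exists y; rewrite 1?setUC].
Qed.

Lemma sadj_iter a i j : a \in alpha -> i <= stop a -> j <= stop a ->
  sadj H (iter i s a) (iter j s a) = (j == i.+1) || (i == j.+1).
Proof.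
move=> aA; have half k l : k <= stop a -> l <= stop a ->
    (iter k s a \in U :\: beta) && (iter l s a == s (iter k s a)) = (l == k.+1).
  move=> ka la; rewrite inE iter_seg_beta //.
  have -> /= : iter k s a \in U by apply/seg_vertsP; exists a, k.
  rewrite andbT; apply/andP/eqP => [[ns /eqP]|lk].
    rewrite -iterS => E; apply: (iter_seg_inj aA aA _ _ E).1 => //.
    by rewrite ltn_neqAle ns.
  by rewrite lk eqxx neq_ltn -lk la.
by move=> ia ja; rewrite sadj_linkage !half.
Qed.

(** Consecutive vertices of a segment are adjacent, and no edge leaves it: an edge joins some [z]
    outside [beta] to [s z], the next vertex on the segment of [z], and segments are disjoint. *)
Lemma component_segment a i : a \in alpha -> i <= stop a ->
  [set y in U | connect (sadj H) (iter i s a) y] = [set y in segment a].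
Proof.
move=> aA ia; apply/setP => y; rewrite [LHS]inE [RHS]inE.
have cs := sym_connect_sym (@sadj_sym n H).
have con j : j <= stop a -> connect (sadj H) a (iter j s a).
  elim: j => [_|j IH ja]; first exact: connect0.
  apply: connect_trans (IH (ltnW ja)) (connect1 _).
  by rewrite sadj_iter ?eqxx // ltnW.
apply/andP/idP => [[_]|/segmentP[j ja ->]]; last first.
  split; first by apply/seg_vertsP; exists a, j.
  by apply: connect_trans (con j ja); rewrite cs con.
have /closed_connect cl : closed (sadj H) (mem (segment a)).
  apply: intro_closed => // x z; rewrite sadj_linkage => xz /segmentP[k ka xE].
  apply/segmentP; case/orP: xz => /andP[]; rewrite inE => /andP[].
    rewrite xE iter_seg_beta // => ks _ /eqP->; exists k.+1 => //.
    by rewrite ltn_neqAle ks.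
  move=> zb /seg_vertsP[a' [l [a'A la zE]]] /eqP; rewrite xE zE -iterS.
  have ls : l < stop a'.
    by rewrite ltn_neqAle la andbT -(iter_seg_beta a'A la) -zE.
  case/(iter_seg_inj aA a'A ka ls) => kl aa.
  by exists l; rewrite ?aa.
by move/cl=> <-; apply/segmentP; exists i.
Qed.

Lemma segment_uniq a : a \in alpha -> uniq (segment a).
Proof.
move=> aA; rewrite looping_uniq; apply/trajectP => -[i ia].
case/(iter_seg_inj aA aA (leqnn _) (ltnW ia)) => E.
by rewrite -E ltnn in ia.
Qed.

Lemma perm_ab_linkage : ab_linkage G alpha beta H.
Proof.
have comp C : C \in components H -> exists a b, [/\ path_between H C a b,
    alpha :&: C = [set a] & beta :&: C = [set b]].
  case/imsetP=> x /seg_vertsP[a [i [aA ia ->]]] ->.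
  rewrite component_segment //; exists a, (iter (stop a) s a); split.
  - exists (traject s (s a) (stop a)); split.
    + exact: segment_uniq.
    + exact: last_traject.
    + by [].
    move=> y z; rewrite !inE => /segmentP[k ka ->] /segmentP[l la ->].
    have idx m : m <= stop a -> index (iter m s a) (segment a) = m.
      move=> ma; rewrite -(nth_traject s (n := (stop a).+1)) //.
      by rewrite index_uniq ?size_traject ?segment_uniq.
    by rewrite -/(segment a) !idx // sadj_iter.
  - apply/setP => y; rewrite in_setI in_set in_set1.
    apply/andP/eqP => [[yA /segmentP[j ja yE]]|->].
      by case: (@iter_seg_inj y a 0 j).
    by split=> //; apply/segmentP; exists 0.
  apply/setP => y; rewrite in_setI in_set in_set1.
  apply/andP/eqP => [[yB /segmentP[j ja yE]]|->].
    by move: yB; rewrite yE iter_seg_beta // => /eqP->.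
  by split; [case: (stopP aA)|apply/segmentP; exists (stop a)].
split=> //.
- split; last by move=> C /comp[a [b []]]; exists a, b.
  have sU x : x \in U :\: beta -> s x != x /\ s x \in U.
    rewrite in_setD => /andP[xB /seg_vertsP[a [i [aA ia xE]]]].
    have ia' : i < stop a by rewrite ltn_neqAle ia andbT -(iter_seg_beta aA ia) -xE.
    split; last by apply/seg_vertsP; exists a, i.+1; rewrite xE.
    apply/eqP; rewrite xE -iterS => /(iter_seg_inj aA aA ia' ia)[E _].
    exact: (n_Sn _ (esym E)).
  apply/andP; split.
    apply/subsetP => _ /imsetP[x xU ->]; apply/imsetP; exists (x, s x) => //.
    have [sx _] := sU x xU; move: xU; rewrite in_setD => /andP[xB _].
    by rewrite inE; apply: sG.
  apply/forall_inP => _ /imsetP[x xU ->]; apply/subsetP => z.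
  have [_ sxU] := sU x xU; move: xU; rewrite in_setD => /andP[_ xU].
  by rewrite in_set2 => /orP[]/eqP->.
- by apply/subsetP => a aA; apply/seg_vertsP; exists a, 0.
(* Distinct segments have distinct stops, and [alpha] has as many elements as [beta], so every
   vertex of [beta] is a stop. *)
apply/subsetP => b.
have <- : [set iter (stop a) s a | a in alpha] = beta.
  apply/eqP; rewrite eqEcard; apply/andP; split.
    by apply/subsetP => _ /imsetP[a aA ->]; case: (stopP aA).
  rewrite card_in_imset ?card_imset //; first exact: perm_inj.
  by move=> a a' aA a'A /(iter_seg_inj aA a'A (leqnn _) (leqnn _))[].
by case/imsetP=> a aA ->; apply/seg_vertsP; exists a, (stop a).
Qed.

(** Outside [beta], a vertex of a segment is moved to the next vertex, which differs from it. This
    bounds the degree of a determinant term. *)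
Lemma fixed_notin_linkage : [set i | s i == i] :\: beta \subset ~: H.1.
Proof.
apply/subsetP => x; rewrite 3!inE => /andP[xB /eqP sx]; apply/negP.
case/seg_vertsP=> a [i [aA ia xE]].
have ia' : i < stop a by rewrite ltn_neqAle ia andbT -(iter_seg_beta aA ia) -xE.
move: sx; rewrite xE -iterS => /(iter_seg_inj aA aA ia' ia)[E _].
exact: (n_Sn _ (esym E)).
Qed.

End PermToLinkage.

(** * From a linkage to a permutation *)

Section LinkageToPerm.
Variables (n : nat) (G : sgraph n) (alpha beta : {set 'I_n}) (H : vepair n).
Hypothesis HL : ab_linkage G alpha beta H.

Definition component x := [set y in H.1 | connect (sadj H) x y].

Lemma component_in x : x \in H.1 -> component x \in components H.
Proof. by move=> xH; apply/imsetP; exists x. Qed.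

Lemma mem_component x : x \in H.1 -> x \in component x.
Proof. by move=> xH; rewrite inE xH connect0. Qed.

Lemma eq_component x y : y \in component x -> component x = component y.
Proof.
rewrite inE => /andP[_ xy]; apply/setP => z; rewrite !inE.
by rewrite (same_connect (sym_connect_sym (@sadj_sym n H)) xy).
Qed.

(** A component meets [beta] in a single vertex, so [component] is injective on [beta]. *)
Lemma card_linkage_end : #|beta| <= linkage_order H.
Proof.
case: HL => _ _ /subsetP bH comp; rewrite /linkage_order.
rewrite -(card_in_imset (f := component) (D := mem beta)).
  by rewrite subset_leq_card //; apply/subsetP => _ /imsetP[b /bH bB ->]; apply: component_in.
move=> x y xB yB xy.
have [_ [c [_ _ bE]]] := comp _ (component_in (bH _ xB)).
have := mem_component (bH _ yB); rewrite -xy => yx.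
have : x \in beta :&: component x by rewrite in_setI xB mem_component ?bH.
have : y \in beta :&: component x by rewrite in_setI yB.
by rewrite bE !in_set1 => /eqP-> /eqP->.
Qed.

(** The path is oriented from its end in [alpha] to its end in [beta], so that [next] on [s] follows
    it and returns from the latter end to the former. *)
Definition spans_component (s : seq 'I_n) (C : {set 'I_n}) :=
  exists a p, [/\ s = a :: p, uniq s, C = [set x in s] & [/\ alpha :&: C = [set a],
    beta :&: C = [set last a p] & {in C &, forall x y,
      sadj H x y = (index y s == (index x s).+1) || (index x s == (index y s).+1)}]].

(** The choice is made per component rather than per vertex, which gives all vertices of a path the
    same sequence. *)
Lemma component_seqs : exists S : 'I_n -> seq 'I_n,
  [/\ forall x, x \notin H.1 -> S x = [::],
      forall x, x \in H.1 -> spans_component (S x) (component x) &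
      forall x y, x \in H.1 -> y \in S x -> S y = S x].
Proof.
case: HL => _ _ _ comp.
have /choice[T TP] : forall C, exists s, C \in components H -> spans_component s C.
  move=> C; case: (boolP (C \in components H)) => [CH|]; last by exists [::].
  have [a [b [[p [us lb CE sE] aC bC]]]] := comp C CH.
  by exists (a :: p) => _; exists a, p; split=> //; rewrite lb.
exists (fun x => if x \in H.1 then T (component x) else [::]); split.
- by move=> x /negPf->.
- by move=> x xH; rewrite xH; apply/TP/component_in.
move=> x y xH; rewrite xH => yx.
have [a [p [_ _ CE _]]] := TP _ (component_in xH).
have yC : y \in component x by rewrite CE inE.
have -> : y \in H.1 by move: yC; rewrite inE => /andP[].
by rewrite (eq_component yC).
Qed.

(** [s0] closes each path into a cycle by sending its end in [beta] to its end in [alpha].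
    Uniqueness is by induction on the position along the path: outside [beta], [s x] is the
    successor or the predecessor of [x], and the predecessor is already the image under [s] of
    another vertex, one in [beta] or one earlier on the path. *)
Lemma linkage_perm : exists s0 : {perm 'I_n},
  [/\ s0 @: beta = alpha,
      forall x, x \notin H.1 -> s0 x = x,
      {in H.1 :\: beta, forall x, sadj H x (s0 x)} &
      forall s : {perm 'I_n}, {in beta, s =1 s0} ->
        (forall x, x \notin H.1 -> s x = x) ->
        {in H.1 :\: beta, forall x, sadj H x (s x)} -> s = s0].
Proof.
have [S [S0 SP SE]] := component_seqs.
case: (HL) => -[/andP[_ /forall_inP eH] _] /subsetP aH /subsetP bH comp.
pose f x := next (S x) x.
have memS x y : x \in H.1 -> (y \in S x) = (y \in component x).
  by move=> xH; have [a [p [_ _ -> _]]] := SP x xH; rewrite inE.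
have xS x : x \in H.1 -> x \in S x by move=> xH; rewrite memS // mem_component.
have fH x : x \in H.1 -> f x \in S x by move=> xH; rewrite mem_next xS.
have SH x y : x \in H.1 -> y \in S x -> y \in H.1.
  by move=> xH; rewrite memS // inE => /andP[].
have f0 x : x \notin H.1 -> f x = x by move=> xH; rewrite /f S0.
have fU x : (f x \in H.1) = (x \in H.1).
  by case: (boolP (x \in H.1)) => xH;
      [apply: (SH x) => //; apply: fH | rewrite f0 // (negPf xH)].
have f_inj : injective f.
  move=> x y fxy; have := fU y; rewrite -fxy fU.
  case: (boolP (x \in H.1)) => xH yH; last by rewrite -(f0 x) // fxy f0 // -yH.
  have E : S x = S y.
    by rewrite -(SE x (f x)) ?fH // fxy -(SE y (f y)) ?fH.
  have [a [p [_ us _ _]]] := SP x xH.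
  by move: fxy; rewrite /f -E; apply: (can_inj (prev_next us)).
have fB x : x \in beta -> f x \in alpha.
  move=> xB; have xH := bH x xB.
  have [a [p [SxE us CE [aC bC _]]]] := SP x xH.
  have /eqP xl : x == last a p by rewrite -in_set1 -bC in_setI xB mem_component.
  have /setIP[aA _] : a \in alpha :&: component x by rewrite aC set11.
  (* [next] looks up the tail [p] at the index of [x] in [a :: p]; for the last vertex this is out
     of range, and [nth] returns its default, the first entry [a]. *)
  by rewrite /f next_nth xS // SxE xl index_last -?SxE // nth_default.
have fN x : x \in H.1 -> x \notin beta -> index (f x) (S x) = (index x (S x)).+1.
  move=> xH xB; have [a [p [SxE us CE [aC bC _]]]] := SP x xH.
  have ix : index x (S x) < size p.
    have := xS x xH; rewrite -index_mem {2}SxE /= ltnS leq_eqVlt => /orP[/eqP E|//].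
    have xl : x = last a p by rewrite -(nth_index a (xS x xH)) E SxE /= -last_nth.
    have /setIP[] : x \in beta :&: component x by rewrite bC inE {1}xl.
    by move=> xB'; rewrite xB' in xB.
  have -> : f x = nth a (S x) (index x (S x)).+1 by rewrite /f next_nth xS // SxE.
  by rewrite index_uniq // {2}SxE.
pose s0 := perm f_inj; have s0E x : s0 x = f x by rewrite permE.
have s0B : s0 @: beta = alpha.
  apply/eqP; rewrite eqEsubset; apply/andP; split; apply/subsetP => a.
    by case/imsetP=> b bB ->; rewrite s0E fB.
  move=> aA; have aH' := aH a aA.
  have [a' [p [SaE us CE [aC bC _]]]] := SP a aH'.
  have /eqP aa : a == a' by rewrite -in_set1 -aC in_setI aA mem_component.
  have /setIP[bB bca] : last a' p \in beta :&: component a by rewrite bC set11.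
  apply/imsetP; exists (last a' p) => //; rewrite s0E /f.
  have lS : last a' p \in S a by rewrite memS.
  by rewrite (SE a _ aH' lS) next_nth lS SaE index_last -?SaE // nth_default.
exists s0; split=> //.
- by move=> x xH; rewrite s0E f0.
- move=> x; rewrite in_setD => /andP[xB xH]; rewrite s0E.
  have [a [p [SxE us CE [_ _ ->]]]] := SP x xH.
  + by rewrite fN // eqxx.
  + exact: mem_component.
  by rewrite -memS // fH.
move=> s sB sN sA; apply/permP => x; rewrite s0E.
case: (boolP (x \in H.1)) => xH; last by rewrite sN // f0.
have [k xk] := ubnP (index x (S x)).
elim: k => // k IH in x xH xk *; rewrite ltnS in xk.
case: (boolP (x \in beta)) => xB; first by rewrite sB // s0E.
have sx := sA x; rewrite in_setD xB xH in sx; move/(_ isT): sx => sx.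
have sxH : s x \in H.1.
  by apply: (subsetP (eH _ sx)); rewrite set22.
have sxS : s x \in S x by rewrite memS // inE sxH connect1.
have [a [p [SxE us CE [_ _ adjE]]]] := SP x xH.
move: sx; rewrite adjE ?mem_component -?memS // => /orP[/eqP E|/eqP E].
  by rewrite -(nth_index a sxS) E -fN // nth_index ?fH.
(* [w] is the predecessor of [s x] along its path; [s] agrees with [f] there. *)
pose w := (s0^-1)%g (s x).
have fw : f w = s x by rewrite -s0E /w permKV.
have wH : w \in H.1 by rewrite -fU fw.
case: (boolP (w \in beta)) => wB.
  have /perm_inj wx : s w = s x by rewrite sB // s0E.
  by rewrite wx (negPf xB) in wB.
have SwE : S w = S x by rewrite -(SE w (f w)) ?fH // fw (SE x).
have := fN w wH wB; rewrite fw SwE => iw.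
have wlt : index w (S x) < index x (S x) by rewrite E iw ltnW.
have /perm_inj wx : s w = s x.
  by rewrite IH // SwE (leq_trans wlt).
by rewrite wx ltnn in wlt.
Qed.

End LinkageToPerm.

Local Open Scope ring_scope.

(** * Rank, spectrum and divisibility of determinants *)

Lemma mxrank_sum_le (F : fieldType) (I : finType) (P : pred I) m n
    (B : I -> 'M[F]_(m, n)) :
  (\rank (\sum_(i | P i) B i)%R <= \sum_(i | P i) \rank (B i))%N.
Proof.
elim/big_ind2: _ => [|k1 A1 k2 A2 h1 h2|//]; first by rewrite mxrank0.
by apply: leq_trans (mxrank_add _ _) _; rewrite leq_add.
Qed.

Lemma mxrank_diag_le (F : fieldType) n (d : 'rV[F]_n) :
  (\rank (diag_mx d)%R <= #|[pred i | (d 0 i != 0)%R]|)%N.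
Proof.
rewrite diag_mx_sum_delta (bigID (fun i => d 0 i != 0)) /=.
rewrite [X in _ + X]big1 ?addr0; last first.
  by move=> i /negPn/eqP->; rewrite scale0r.
apply: leq_trans (mxrank_sum_le _ _) _; rewrite -sum1_card.
apply: leq_sum => i _.
by apply: leq_trans (mxrankS (scalemx_sub _ (submx_refl _))) _; rewrite mxrank_delta.
Qed.

(** Over [R[i]] the matrix is Hermitian, hence diagonalizable with real eigenvalues; rank and
    characteristic polynomial are compatible with the field extension. The rank bound says that
    geometric multiplicities reach the algebraic ones. *)
Lemma symmetric_spectrum (R : rcfType) n (A : 'M[R]_n) : A^T = A ->
  exists d : 'I_n -> R, char_poly A = \prod_i ('X - (d i)%:P) /\
    forall a, (\rank (a%:M - A)%R + #|[pred i | d i == a]| <= n)%N.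
Proof.
move=> Asym; pose f : {rmorphism R -> R[i]} := real_complex R.
pose B := map_mx f A.
have Bh : B \is hermsymmx.
  apply: realsym_hermsym.
    by apply/is_hermitianmxP; rewrite expr0 scale1r map_mx_id // map_trmx Asym.
  by apply/mxOverP => i j; rewrite mxE /= complex_real.
have /orthomx_spectralP := hermitian_normalmx Bh.
set P := spectralmx B; set e := spectral_diag B => BE.
have Pu : P \in unitmx by exact: spectral_unit.
have eR i : exists x, e 0 i = f x.
  have /mxOverP/(_ 0 i) := hermitian_spectral_diag_real Bh.
  by move/complex_realP.
pose d i := complex.Re (e 0 i).
have dE i : e 0 i = f (d i) by rewrite /d; case: (eR i) => x ->.
have sim (a : R[i]) : a%:M - B = invmx P *m (a%:M - diag_mx e) *m P.
  by rewrite mulmxBr mulmxBl -BE mul_mx_scalar -scalemxAl mulVmx // scalemx1.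
have diagB (S : comRingType) (x : S) (v : 'rV[S]_n) :
    x%:M - diag_mx v = diag_mx (const_mx x - v).
  by rewrite -diag_const_mx -linearB.
exists d; split; last first.
  move=> a; rewrite -(mxrank_map f) map_mxB map_scalar_mx /= -/B sim.
  have rk : (\rank ((f a)%:M - diag_mx e)%R <= #|[pred i | d i != a]|)%N.
    rewrite diagB; apply: leq_trans (mxrank_diag_le _) _.
    rewrite subset_leq_card //; apply/subsetP => i; rewrite !inE !mxE dE.
    by apply: contraNneq => ->; rewrite subrr.
  have cn : (#|[pred i | d i != a]| + #|[pred i | d i == a]| = n)%N.
    by rewrite addnC -[RHS]card_ord -(cardC [pred i | d i == a]).
  rewrite -[leqRHS]cn leq_add2r; apply: leq_trans (mxrankM_maxl _ _) _.
  apply: leq_trans (mxrankM_maxr _ _) _; exact: rk.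
apply: (map_poly_inj f).
rewrite map_char_poly -/B rmorph_prod /=.
under eq_bigr => i _ do rewrite rmorphB /= map_polyX map_polyC /= -dE.
have simX : char_poly_mx B
    = map_mx polyC (invmx P) *m ('X%:M - map_mx polyC (diag_mx e)) *m map_mx polyC P.
  rewrite mulmxBr mulmxBl -!map_mxM -BE mul_mx_scalar -scalemxAl -map_mxM.
  by rewrite mulVmx // map_mx1 scalemx1.
rewrite /char_poly simX !det_mulmx mulrAC -det_mulmx -map_mxM mulVmx // map_mx1.
rewrite det1 mul1r map_diag_mx diagB det_diag.
by apply: eq_bigr => i _; rewrite !mxE.
Qed.

(* Constant row operations make all but [r] rows of [M] vanish at [a]. *)
Lemma dvd_det_mxrank (F : fieldType) n (M : 'M[{poly F}]_n) (a : F) r :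
  (\rank (map_mx (horner_eval a) M) <= r)%N ->
  ('X - a%:P) ^+ (n - r) %| \det M.
Proof.
set N := map_mx _ M => rkN.
(* [u] undoes the left factor of the rank factorization of [N], so the rows of [u *m N] from index
   [\rank N] on vanish. *)
pose u := invmx (col_ebase N).
have Nu (i j : 'I_n) : (r <= i)%N -> (u *m N) i j = 0.
  move=> ri; rewrite -(mulmx_ebase N) !mulmxA mulVmx ?col_ebase_unit // mul1mx.
  rewrite mxE big1 // => k _.
  by rewrite mxE ltnNge (leq_trans rkN ri) andbF mul0r.
pose L := map_mx polyC u *m M.
have LN : map_mx (horner_eval a) L = u *m N.
  rewrite map_mxM -map_mx_comp map_mx_id // => c /=.
  by rewrite /horner_eval /= hornerC.
pose D := \row_(i < n) (if (i < r)%N then 1 else 'X - a%:P).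
(* Each row of [L] from index [r] on vanishes at [a], so a factor ['X - a%:P] can be pulled out of
   it. *)
have LD : L = diag_mx D *m (\matrix_(i, j) (L i j %/ D 0 i)).
  apply/matrixP => i j; rewrite mul_diag_mx !mxE mulrC.
  case: ltnP => ri; first by rewrite divp1 mulr1.
  rewrite divpK //; rewrite dvdp_XsubCl; apply/rootP.
  by have := congr1 (fun X : 'M_n => X i j) LN; rewrite mxE Nu // !mxE.
have uu : \det (map_mx polyC u) %= 1.
  rewrite det_map_mx -size_poly_eq1 size_polyC.
  by rewrite -unitfE -unitmxE unitmx_inv col_ebase_unit.
have : ('X - a%:P) ^+ (n - r) %| \det L.
  rewrite LD det_mulmx det_diag; apply: dvdp_mulr.
  rewrite (bigID (fun i : 'I_n => (i < r)%N)) /=.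
  rewrite big1 ?mul1r; last by move=> i ri; rewrite mxE ri.
  rewrite (eq_bigr (fun=> 'X - a%:P)); last by move=> i /negPf ri; rewrite mxE ri.
  rewrite prodr_const; apply: dvdp_exp2l.
  rewrite -[n in (n - r)%N]card_ord -(cardC [pred i : 'I_n | (i < r)%N]) leq_subLR leq_add2r.
  case: (leqP r n) => rn; last by rewrite (leq_trans (max_card _)) // card_ord ltnW.
  by rewrite -sum1_card -(big_ord_widen n (fun=> 1%N)) // sum1_card card_ord.
by rewrite det_mulmx (eqp_dvdr _ (eqp_mulr _ uu)) mul1r.
Qed.

(** Powers of distinct linear factors are coprime, so their product divides [p]. The inequality is
    strict because [size] is the degree plus one. *)
Lemma sum_mup_lt_size (F : fieldType) (p : {poly F}) (m : F -> nat) (s : seq F) :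
  uniq s -> p != 0 -> {in s, forall a, ('X - a%:P) ^+ m a %| p} ->
  (\sum_(a <- s) m a < size p)%N.
Proof.
move=> us p0 sp.
have : \prod_(a <- s) ('X - a%:P) ^+ m a %| p.
  elim: s us sp => [|a s IH] /=; first by rewrite big_nil dvd1p.
  case/andP=> as_ us sp; rewrite big_cons Gauss_dvdp; last first.
    rewrite big_seq; apply: (big_ind (fun q => coprimep _ q)).
    - exact: coprimep1.
    - by move=> q1 q2 h1 h2; rewrite coprimepMr h1.
    move=> b bs; apply: coprimep_expl; apply: coprimep_expr.
    by rewrite coprimep_XsubC root_XsubC; apply: contraNneq as_ => <-.
  rewrite sp ?mem_head // IH // => b bs; apply: sp; by rewrite inE bs orbT.
move/(dvdp_leq p0); apply: leq_trans.
rewrite size_prod_seq; last by move=> a _; rewrite expf_neq0 // polyXsubC_eq0.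
under [in X in (_ < X)%N]eq_bigr => a _ do rewrite size_exp_XsubC -addn1.
rewrite big_split /= sum1_size -addSn addnK.
by [].
Qed.

(** * The minor attached to a linkage and its degree *)

Section LinkageMinor.
Variables (R : realType) (n : nat) (G : sgraph n) (A : 'M[R]_n).
Hypothesis AG : in_S G A.
Variables (beta : {set 'I_n}) (s0 : {perm 'I_n}).

(* Up to sign, [\det pencil] is the minor of 'X - A with rows [beta] and columns
   [s0 @: beta] deleted. *)
Definition pencil : 'M[{poly R}]_n :=
  \matrix_(i, j) (if i \in beta then (j == s0 i)%:R else char_poly_mx A i j).

Lemma size_pencil_entry i j : pencil i j != 0 ->
  size (pencil i j) = (1 + ((i \notin beta) && (j == i)))%N.
Proof.
rewrite !mxE; case: (i \in beta).
  by case: (j == s0 i); rewrite ?size_poly1 ?eqxx.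
case: (eqVneq j i) => [->|ji].
  by rewrite mulr1n size_XsubC.
rewrite andbF.
by rewrite mulr0n sub0r size_polyN size_polyC oppr_eq0 polyC_eq0 => ->.
Qed.

Lemma pencil_term_size (s : {perm 'I_n}) : (forall i, pencil i (s i) != 0) ->
  size ((-1) ^+ s * \prod_i pencil i (s i)) = #|[set i | s i == i] :\: beta|.+1.
Proof.
move=> nz; rewrite size_Msign size_prod //.
under eq_bigr => i _ do rewrite size_pencil_entry //.
rewrite big_split /= sum1_card -addnS addKn; congr _.+1.
rewrite -sum1_card [RHS]big_mkcond; apply: eq_bigr => i _.
by rewrite !inE; case: (_ && _).
Qed.

(** These two facts allow [perm_linkage] to read [s] as a linkage of [G] from [s0 @: beta] to
    [beta]. *)
Lemma pencil_term_neq0 (s : {perm 'I_n}) : (forall i, pencil i (s i) != 0) ->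
  {in beta, s =1 s0} /\ (forall i, i \notin beta -> s i != i -> G i (s i)).
Proof.
move=> nz; split=> i; have := nz i; rewrite !mxE.
  by move=> M0 iB; apply/eqP; move: M0; rewrite iB; case: (s i == _); rewrite ?eqxx.
move=> /[swap]/negPf-> /[swap] si; rewrite [i == _]eq_sym (negPf si) mulr0n.
by rewrite sub0r oppr_eq0 polyC_eq0 AG.2 1?eq_sym.
Qed.

End LinkageMinor.

Lemma size_det_pencil (R : realType) n (G : sgraph n) (A : 'M[R]_n) H :
  in_S G A -> rigid_shortest_linkage G H ->
  exists (beta : {set 'I_n}) (s0 : {perm 'I_n}), (#|beta| <= linkage_order H)%N /\
    size (\det (pencil A beta s0)) = (n - #|H.1|).+1.
Proof.
move=> AG [alpha [beta [[HL Hmin] Huniq]]].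
have [s0 [s0B s0N s0A s0uniq]] := linkage_perm HL.
exists beta, s0; split; first exact: card_linkage_end HL.
case: (HL) => -[/andP[/subsetP HE _] _] _ /subsetP bH _.
have s0G x : x \in H.1 -> x \notin beta -> G x (s0 x).
  move=> xH xB; have := s0A x; rewrite in_setD xB xH => /(_ isT) /HE.
  case/imsetP=> -[y z] yz /set2_eq /= [] [-> ->]; first by rewrite inE in yz.
  by rewrite adj_sym; rewrite inE in yz.
have s0fix x : (x \notin beta) && (s0 x == x) = (x \notin H.1).
  case: (boolP (x \in H.1)) => xH; last first.
    by rewrite s0N // eqxx andbT; apply: contra xH => /bH.
  apply/negbTE; rewrite negb_and negbK; case: (boolP (x \in beta)) => //= xB.
  apply: contraTneq (s0G x xH xB) => ->; by rewrite adj_irr.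
have nz0 i : pencil A beta s0 i (s0 i) != 0.
  rewrite !mxE; case: (boolP (i \in beta)) => iB; first by rewrite eqxx oner_eq0.
  case: (eqVneq i (s0 i)) => si; first by rewrite -si mulr1n polyXsubC_eq0.
  rewrite mulr0n sub0r oppr_eq0 polyC_eq0 AG.2 // s0G //.
  by apply: contraNT si => iH; rewrite s0N.
have cardC : #|~: H.1| = (n - #|H.1|)%N by rewrite cardsCs setCK card_ord.
have sz0 := pencil_term_size nz0.
have E0 : [set i | s0 i == i] :\: beta = ~: H.1.
  by apply/setP => x; rewrite !inE s0fix.
rewrite E0 cardC in sz0.
(* The term of [s0] has degree [n - #|H.1|]; it cannot cancel once all other terms are shown to have
   smaller degree. *)
rewrite /determinant (bigD1 s0) //= size_polyDl sz0 // ltnS.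
apply: leq_trans (size_sum _ _ _) _; apply/bigmax_leqP => s ss0.
case: (boolP [forall i, pencil A beta s0 i (s i) != 0]) => [/forallP nz|]; last first.
  rewrite negb_forall => /existsP[k]; rewrite negbK => /eqP Mk.
  by rewrite (bigD1 k) //= Mk mul0r mulr0 size_poly0.
rewrite (pencil_term_size nz).
have [sB sG] := pencil_term_neq0 AG nz.
have KL := perm_ab_linkage sG; have fixK := fixed_notin_linkage beta s.
set K := perm_linkage beta s in KL fixK.
have saB : s @: beta = alpha by rewrite -s0B; apply: eq_in_imset.
rewrite saB in KL.
have leHK := Hmin _ KL; have cfix := subset_leq_card fixK.
have cardK : #|~: K.1| = (n - #|K.1|)%N by rewrite cardsCs setCK card_ord.
(* If the term of [s] has degree at least [n - #|H.1|], then [K] has no more vertices than [H],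
   hence equals [H] by rigidity; it remains to deduce [s = s0]. *)
rewrite ltnNge; apply: contra ss0 => le_fix; apply/eqP.
have Kn : (#|K.1| <= n)%N by rewrite -[n in leqRHS]card_ord max_card.
have HK : #|K.1| = #|H.1|.
  apply/eqP; rewrite eqn_leq leHK andbT -(leq_sub2lE _ Kn) -cardK.
  exact: leq_trans le_fix cfix.
have KH : K = H by apply: Huniq.
(* Equality of cardinalities makes [s] fix every vertex off [H], as [s0uniq] requires. *)
have fixE : [set i | s i == i] :\: beta = ~: H.1.
  by apply/eqP; rewrite -KH eqEcard fixK cardK HK.
apply: s0uniq => // x.
  by rewrite -in_setC -fixE !inE => /andP[_ /eqP].
by rewrite -KH => xK; rewrite sadj_linkage xK eqxx.
Qed.

(** * Multiplicities and the sum of the [qmult i A] *)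

Lemma mup_prod_XsubC (F : fieldType) (I : finType) (d : I -> F) (a : F) :
  mup a (\prod_i ('X - (d i)%:P)) = #|[pred i | d i == a]|.
Proof.
have -> : #|[pred i | d i == a]| = (\sum_i (d i == a))%N.
  by rewrite -sum1_card big_mkcond; apply: eq_bigr => i _; rewrite inE; case: eqP.
suff [] : \prod_i ('X - (d i)%:P) != 0 /\
    mup a (\prod_i ('X - (d i)%:P)) = (\sum_i (d i == a))%N by [].
elim/big_rec2: _ => [|i k p _ [p0 IH]].
  by rewrite oner_eq0 mupNroot // rootC oner_eq0.
rewrite mulf_neq0 ?polyXsubC_eq0 //; split=> //.
by rewrite mupM ?polyXsubC_eq0 // IH -['X - _]expr1 mup_XsubCX; case: eqP.
Qed.

(** Double counting of the pairs of an index [i] and an eigenvalue of multiplicity at least [i]: an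
    eigenvalue of multiplicity [m] is counted for [minn m t] indices. *)
Lemma sum_qmult (R : realType) n (A : 'M[R]_n) (s : seq R) t :
  uniq s -> (forall a, (a \in s) = eigenvalue A a) ->
  (\sum_(1 <= i < t.+1) qmult i A = \sum_(a <- s) minn (eigmult A a) t)%N.
Proof.
move=> us sE.
have qE i : qmult i A = (\sum_(a <- s) (i <= eigmult A a))%N.
  have -> : (\sum_(a <- s) (i <= eigmult A a) = size [seq a <- s | i <= eigmult A a])%N.
    by rewrite size_filter -sumn_count sumnE big_map.
  rewrite /qmult; apply: perm_size; apply: uniq_perm.
  - exact: fset_uniq.
  - exact: filter_uniq.
  move=> a; rewrite in_fset_set; last exact: eig_ge_finite.
  rewrite mem_filter sE andbC; by apply/idP/andP => [/set_mem|/mem_set].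
under eq_bigr => i _ do rewrite qE.
rewrite exchange_big; apply: eq_bigr => a _ /=.
elim: t => [|t IH]; first by rewrite big_nil minn0.
rewrite big_nat_recr //= IH; case: (ltnP t (eigmult A a)) => tm.
  by rewrite (minn_idPr tm) addn1.
by rewrite addn0 (minn_idPl (leqW tm)).
Qed.

(** * The inequality for one linkage, and the two bounds *)

Lemma rigid_linkage_le (R : realType) n (G : sgraph n) (A : 'M[R]_n) H :
  in_S G A -> rigid_shortest_linkage G H ->
  (#|H.1| <= \sum_(1 <= i < (linkage_order H).+1) qmult i A)%N.
Proof.
move=> AG HR; set t := linkage_order H.
have [beta [s0 [bt szM]]] := size_det_pencil AG HR; rewrite -/t in bt.
set M := pencil A beta s0 in szM.
have [d [chi rk]] := symmetric_spectrum AG.1.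
have mE a : eigmult A a = #|[pred i | d i == a]| by rewrite /eigmult chi mup_prod_XsubC.
have mn a : (eigmult A a <= n)%N by rewrite mE -[n in leqRHS]card_ord max_card.
pose s := undup (map d (enum 'I_n)).
have sE a : (a \in s) = eigenvalue A a.
  rewrite mem_undup eigenvalue_root_char chi.
  have -> : \prod_i ('X - (d i)%:P) = \prod_(b <- map d (enum 'I_n)) ('X - b%:P).
    by rewrite big_map big_enum.
  by rewrite root_prod_XsubC.
have us : uniq s by exact: undup_uniq.
rewrite (sum_qmult t us sE).
have M0 : \det M != 0 by rewrite -size_poly_gt0 szM.
have dvdM a : ('X - a%:P) ^+ (eigmult A a - t) %| \det M.
  have rM : (\rank (map_mx (horner_eval a) M) <= n - eigmult A a + t)%N.
    (* At [a] the matrix [M] differs from [a%:M - A] only in the rows of [beta], at most [t] of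
       them, so the rank grows by at most [t]. *)
    have -> : map_mx (horner_eval a) M = (a%:M - A) +
        diag_mx (\row_i (i \in beta)%:R) *m (map_mx (horner_eval a) M - (a%:M - A)).
      apply/matrixP => i j; rewrite mul_diag_mx !mxE.
      case: (i \in beta); first by rewrite mul1r addrC subrK.
      by rewrite mul0r addr0 /horner_eval hornerD hornerN hornerC hornerMn hornerX.
    apply: leq_trans (mxrank_add _ _) (leq_add _ _).
      by rewrite leq_subRL // addnC mE rk.
    apply: leq_trans (mxrankM_maxl _ _) (leq_trans (mxrank_diag_le _) _).
    apply: leq_trans bt; rewrite subset_leq_card //; apply/subsetP => i.
    by rewrite inE mxE; case: (i \in beta); rewrite ?eqxx.
  apply: dvdp_trans (dvd_det_mxrank rM); apply: dvdp_exp2l.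
  by rewrite subnDA subKn.
have sM : (\sum_(a <- s) eigmult A a = n)%N.
  under eq_bigr => a _ do rewrite mE -sum1_card big_mkcond /=.
  rewrite exchange_big -[RHS]card_ord -sum1_card; apply: eq_bigr => i _ /=.
  rewrite -big_mkcond sum1_count -[RHS](_ : (d i \in s) = 1%N :> nat).
    rewrite -count_uniq_mem //; apply: eq_count => a; exact: eq_sym.
  by rewrite mem_undup map_f // mem_enum.
have := sum_mup_lt_size us M0 (fun a _ => dvdM a).
rewrite szM ltnS => le.
have Hn : (#|H.1| <= n)%N by rewrite -[n in leqRHS]card_ord max_card.
(* With [n - #|H.1|] added to both sides, the left side is [n], the sum of the multiplicities [m],
   and each [m] is [minn m t + (m - t)] with truncated subtraction. *)
rewrite -(leq_add2r (n - #|H.1|)) subnKC // -{1}sM.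
apply: leq_trans (leq_add (leqnn _) le); rewrite -big_split /=.
by apply: leq_sum => a _; rewrite minnE addnC subnKC // leq_subr.
Qed.

Lemma qmult_le (R : realType) n (A : 'M[R]_n) i j :
  (i <= j)%N -> (qmult j A <= qmult i A)%N.
Proof.
move=> ij; apply: uniq_leq_size; first exact: fset_uniq.
move=> a; rewrite !in_fset_set; try exact: eig_ge_finite.
by case/set_mem=> aA ja; apply/mem_set; split=> //; apply: leq_trans ja.
Qed.

Lemma RSL_le_sum_qmult (R : realType) n (G : sgraph n) (A : 'M[R]_n) t :
  in_S G A -> (RSL G t <= \sum_(1 <= i < t.+1) qmult i A)%N.
Proof.
move=> AG; apply/bigmax_leqP => H /andP[/asboolP HR /eqP <-].
exact: rigid_linkage_le AG HR.
Qed.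

Theorem theorem5p4 (R : realType) (n : nat) (G : sgraph n) (A : 'M[R]_n)
    (hA : in_S G A) (t : nat) (ht : (0 < t)%N) :
  (RSL G t <= \sum_(1 <= i < t.+1) qmult i A)%N /\
  Num.ceil ((RSL G t)%:R / t%:R : rat) <= (qgraph R G)%:Z.
Proof.
split; first exact: RSL_le_sum_qmult.
(* [B] attains the minimum defining [qgraph R G]; the first bound is applied to [B] instead of [A],
   and each [qmult i B] is at most [qmult 1 B]. *)
rewrite /qgraph; case: ex_minnP => q /asboolP[B BG <-] _.
rewrite ceil_le_int ler_pdivrMr ?ltr0n // -[_%:~R]/((qmult 1 B)%:R) -natrM ler_nat.
apply: leq_trans (RSL_le_sum_qmult t BG) _.
have -> : (qmult 1 B * t = \sum_(1 <= i < t.+1) qmult 1 B)%N.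
  by rewrite sum_nat_const_nat subn1 mulnC.
by rewrite big_nat [leqRHS]big_nat leq_sum // => i /andP[/qmult_le].
Qed.
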